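(* Let $\Omega\subset\mathbb{R}^2$ be a bounded strictly convex domain with smooth boundary $\partial\Omega$, and let $d$ be the radius of the largest ball inscribed in $\Omega$. Let $\alpha>1$ and suppose $d<\pi/2$. Let $u$ be a solution of $$\mathrm{div}\left(\frac{\nabla u}{\sqrt{1+|\nabla u|^2}}\right)=\left(\frac{1}{\sqrt{1+|\nabla u|^2}}\right)^{\alpha}\ \text{ in }\Omega,\qquad u=0\ \text{ on }\partial\Omega,$$ and put $u_{\min}=\min_{\overline{\Omega}}u$. Then $$-u_{\min}\leq\frac{1}{\alpha-1}\left(\left(\frac{1}{\cos(d)}\right)^{\alpha-1}-1\right).$$
   Context: Strict convexity of $\Omega$ means that the curvature $\kappa$ of $\partial\Omega$, as a planar curve, computed with respect to the inward orientation, satisfies $\kappa>0$ on $\partial\Omega$. Solutions are understood as classical solutions, smooth on $\overline{\Omega}$. *)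

(* Defs.v *)
From HB Require Import structures.
From mathcomp Require Import all_boot all_order all_algebra.
From mathcomp Require Import all_classical all_reals all_analysis.

Set Implicit Arguments.
Unset Strict Implicit.
Unset Printing Implicit Defensive.

Import Order.TTheory GRing.Theory Num.Theory.
Import numFieldNormedType.Exports.

Local Open Scope classical_set_scope.
Local Open Scope ring_scope.

(* The plane is 'rV[R]_2.  The library norm `|x| on 'rV[R]_2 is the sup norm;
   it is used only through the topology (and boundedness) it induces.  Every
   metric notion below goes through the Euclidean norm [enorm]. *)

Section Plane.
Context {R : realType}.
Implicit Types (v w p : 'rV[R]_2) (A : set 'rV[R]_2).

Definition dot v w : R := \sum_i v 0 i * w 0 i.
Definition enorm v : R := Num.sqrt (dot v v).
Definition eball p (r : R) : set 'rV[R]_2 := [set x | enorm (x - p) < r].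

(* rotation by a quarter turn counterclockwise *)
Definition rot90 v : 'rV[R]_2 := \row_i (if i == 0 then - v 0 1 else v 0 0).

Definition frontier A : set 'rV[R]_2 := closure A `\` A°.

Definition domain A : Prop := [/\ open A, connected A & A !=set0].

End Plane.

Section Boundary.
Context {R : realType}.
Implicit Types (Omega : set 'rV[R]_2).

Definition smooth_curve (V : normedModType R) (f : R -> V) : Prop :=
  forall (n : nat) (t : R), derivable f^`(n)%classic t 1.

(* Near each boundary point, in some orthonormal frame (e, rot90 e), Omega is
   the region strictly above the graph of a smooth function. *)
Definition smooth_boundary Omega : Prop :=
  forall p, frontier Omega p ->
  exists (e : 'rV[R]_2) (f : R -> R) (r : R),
    [/\ enorm e = 1, smooth_curve f, 0 < r &
        forall x, eball p r x ->
          (Omega x <-> f (dot (x - p) e) < dot (x - p) (rot90 e))].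

(* curvature of a regular planar curve with respect to the normal
   rot90 (gamma' t), i.e. det (gamma', gamma'') / |gamma'|^3 *)
Definition signed_curvature (gamma : R -> 'rV[R]_2) (t : R) : R :=
  dot (rot90 (gamma^`()%classic t)) (gamma^`(2)%classic t) / enorm (gamma^`()%classic t) ^+ 3.

(* [k] is the curvature of the boundary of Omega at p for the inward
   orientation: it is computed along a smooth curve, regular at p, which near
   p runs in the boundary with Omega on the side of rot90 (gamma'). *)
Definition boundary_curvature Omega (p : 'rV[R]_2) (k : R) : Prop :=
  exists (gamma : R -> 'rV[R]_2) (t : R),
    [/\ smooth_curve gamma, gamma t = p & gamma^`()%classic t != 0] /\
    [/\ \forall s \near t, frontier Omega (gamma s),
        \forall h \near 0^'+, Omega (p + h *: rot90 (gamma^`()%classic t))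
      & k = signed_curvature gamma t].

Definition strictly_convex Omega : Prop :=
  forall p k, frontier Omega p -> boundary_curvature Omega p k -> 0 < k.

(* Balls are open: an open set contains no largest closed ball. *)
Definition is_inradius Omega (d : R) : Prop :=
  (exists c, eball c d `<=` Omega) /\
  (forall c r, eball c r `<=` Omega -> r <= d).

End Boundary.

Section Calculus.
Context {R : realType}.
Implicit Types (u : 'rV[R]_2 -> R) (Omega : set 'rV[R]_2).

Definition partial (i : 'I_2) u : 'rV[R]_2 -> R := fun x => 'D_('e_i) u x.

Definition partials (s : seq 'I_2) u : 'rV[R]_2 -> R := foldr partial u s.

Definition grad u (x : 'rV[R]_2) : 'rV[R]_2 := \row_i partial i u x.

Definition div (X : 'rV[R]_2 -> 'rV[R]_2) (x : 'rV[R]_2) : R :=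
  \sum_i partial i (fun y => X y 0 i) x.

(* u is continuous on the closure of Omega, has partial derivatives of all
   orders in Omega, and each of them extends continuously to the closure.
   The values of u outside the closure are irrelevant. *)
Definition smooth_upto_closure Omega u : Prop :=
  {within closure Omega, continuous u} /\
  forall s : seq 'I_2,
    (forall (i : 'I_2) x, Omega x -> derivable (partials s u) x 'e_i) /\
    (exists g : 'rV[R]_2 -> R,
       {within closure Omega, continuous g} /\
       (forall x, Omega x -> g x = partials s u x)).

(* 1 / sqrt (1 + |grad u|^2) *)
Definition slope_factor u (x : 'rV[R]_2) : R :=
  (Num.sqrt (1 + enorm (grad u x) ^+ 2))^-1.

Definition is_solution Omega (alpha : R) u : Prop :=
  [/\ smooth_upto_closure Omega u,
      forall x, Omega x ->
        div (fun y => slope_factor u y *: grad u y) x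
          = (slope_factor u x) `^ alpha
    & forall x, frontier Omega x -> u x = 0].

Definition is_min_on (A : set 'rV[R]_2) u (m : R) : Prop :=
  (exists2 x, A x & u x = m) /\ (forall x, A x -> m <= u x).

End Calculus.

(* Main.v *)
Require Import Defs.
From mathcomp Require Import all_boot all_order all_algebra.
From mathcomp Require Import all_classical all_reals all_analysis.
From mathcomp Require Import ring lra.
Set Implicit Arguments.
Unset Strict Implicit.
Unset Printing Implicit Defensive.

Import Order.TTheory GRing.Theory Num.Theory.
Import numFieldNormedType.Exports.
Local Open Scope classical_set_scope.
Local Open Scope ring_scope.

(** The bound comes from comparing [u] with a function of the distance to the
    boundary.  Write [delta] for the distance to the complement of [Omega], so
    that [delta <= d], fix [d < D < pi / 2], and put
    [barrier y = (cos y `^ (1 - alpha) - 1) / (alpha - 1)].  The claim is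
    [barrier (D - delta) - barrier D <= u] on the closure of [Omega]; as
    [barrier >= 0] this gives [- barrier D <= u], and letting [D] decrease to
    [d] gives the theorem.

    To see the claim, let [x] minimise [u - barrier (D - delta)].  On the
    boundary both [u] and [delta] vanish and the claim holds with equality, so
    it is enough to exclude that [x] lies in [Omega].  Let then [p] be a nearest
    boundary point and [n] the unit vector from [p] to [x].  Clearly
    [delta (x + t n) <= delta x + t].  Positive curvature puts the boundary near
    [p] on the inner side of its tangent line ([tangent_segment]), which is
    orthogonal to [n] ([nearest_tangent]); moving [x] and [p] in parallel
    along this line gives [delta (x + t rot90 n) <= delta x].  Since
    [barrier] is increasing, [t |-> u (x + t n) - barrier (D - delta x - t)] and
    [t |-> u (x + t rot90 n)] have local minima at [0].  Hence
    [grad u = - barrier' n], the second derivative of [u] along [n] is at least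
    [barrier''] and the one along [rot90 n] is nonnegative.  In the frame
    [n, rot90 n] the left side of the equation is
    [s ^ 3 * (u_nn + (1 + |grad u|^2) * u_tt)] with [s] the slope factor
    ([div_flux_frame]), so the equation would yield
    [s ^ 3 * barrier'' <= s ^ alpha]; but [barrier] is a strict subsolution of
    the one-dimensional equation for positive arguments ([barrier_strict]), and
    [D - delta x >= D - d > 0].

    Distances to lines thus replace [delta] wherever derivatives are taken, so
    that [delta] only has to be continuous. *)

(** * Euclidean geometry of the plane *)

Section EuclideanPlane.
Context {R : realType}.
Implicit Types (x y v w p q n : 'rV[R]_2) (t s : R).

Lemma dotE v w : dot v w = v 0 0 * w 0 0 + v 0 1 * w 0 1.
Proof.
rewrite /dot big_ord_recl big_ord1 (_ : lift ord0 ord0 = 1)//.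
exact: val_inj.
Qed.

Lemma row2P v w : v 0 0 = w 0 0 -> v 0 1 = w 0 1 -> v = w.
Proof.
move=> h0 h1; apply/rowP => i; case: (unliftP 0 i) => [j|] -> //.
by rewrite (ord1 j) (_ : lift 0 0 = 1) //; exact: val_inj.
Qed.

Lemma rot90E0 v : rot90 v 0 0 = - v 0 1.
Proof. by rewrite mxE eqxx. Qed.

Lemma rot90E1 v : rot90 v 0 1 = v 0 0.
Proof. by rewrite mxE. Qed.

Lemma dot_ge0 v : 0 <= dot v v.
Proof. by rewrite dotE addr_ge0// -expr2 sqr_ge0. Qed.

Lemma enorm_ge0 v : 0 <= enorm v.
Proof. exact: sqrtr_ge0. Qed.

Lemma sqr_enorm v : enorm v ^+ 2 = dot v v.
Proof. by rewrite sqr_sqrtr// dot_ge0. Qed.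

Lemma enorm0 : enorm (0 : 'rV[R]_2) = 0.
Proof. by rewrite /enorm dotE !mxE mulr0 addr0 sqrtr0. Qed.

Lemma enormZ t v : enorm (t *: v) = `|t| * enorm v.
Proof.
rewrite /enorm (_ : dot (t *: v) (t *: v) = t ^+ 2 * dot v v); last first.
  by rewrite !dotE !mxE; ring.
by rewrite sqrtrM ?sqr_ge0// sqrtr_sqr.
Qed.

Lemma enormN v : enorm (- v) = enorm v.
Proof. by rewrite -scaleN1r enormZ normrN1 mul1r. Qed.

Lemma enormB v w : enorm (v - w) = enorm (w - v).
Proof. by rewrite -enormN opprB. Qed.

Lemma dot_le_enorm v w : dot v w <= enorm v * enorm w.
Proof.
rewrite -sqrtrM ?dot_ge0// (le_trans (ler_norm _))// -sqrtr_sqr ler_sqrt.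
  rewrite !dotE -subr_ge0.
  by apply: le_trans (sqr_ge0 (v 0 0 * w 0 1 - v 0 1 * w 0 0)) _;
     rewrite le_eqVlt; apply/orP; left; apply/eqP; ring.
by rewrite mulr_ge0// dot_ge0.
Qed.

Lemma enormD v w : enorm (v + w) <= enorm v + enorm w.
Proof.
rewrite -(@ler_pXn2r _ 2)// ?nnegrE ?addr_ge0 ?enorm_ge0//.
rewrite sqr_enorm sqrrD !sqr_enorm.
have -> : dot (v + w) (v + w) = dot v v + dot v w *+ 2 + dot w w.
  by rewrite !dotE !mxE; ring.
by rewrite lerD2r lerD2l lerMn2r dot_le_enorm.
Qed.

Lemma enorm_eq0 v : enorm v = 0 -> v = 0.
Proof.
move=> v0; have := sqr_enorm v; rewrite v0 expr0n/= dotE -!expr2 => /esym/eqP.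
rewrite paddr_eq0 ?sqr_ge0// !sqrf_eq0 => /andP[/eqP a /eqP b].
by apply: row2P; rewrite mxE.
Qed.

Lemma norm_le_enorm v : `|v| <= enorm v.
Proof.
rewrite [leLHS]/Num.Def.normr/= mx_normrE (bigmax_le _ (enorm_ge0 v))//=.
move=> -[i j] _ /=; rewrite (ord1 i) {i}.
rewrite -sqrtr_sqr ler_sqrt ?dot_ge0// dotE !expr2.
have [->|->] : j = 0 \/ j = 1.
- by case: (unliftP 0 j) => [k|] ->; [right; rewrite (ord1 k); exact: val_inj|left].
- by rewrite lerDl -expr2 sqr_ge0.
- by rewrite lerDr -expr2 sqr_ge0.
Qed.

Lemma coord_le_norm v i : `|v 0 i| <= `|v|.
Proof.
rewrite [leRHS]/Num.Def.normr/= mx_normrE.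
exact: (le_bigmax _ (fun ij => `|v ij.1 ij.2|) (0, i)).
Qed.

Lemma enorm_le_norm v : enorm v <= 2 * `|v|.
Proof.
rewrite -(@ler_pXn2r _ 2)// ?nnegrE ?mulr_ge0 ?enorm_ge0//.
rewrite sqr_enorm dotE -!expr2.
rewrite -(real_normK (num_real (v 0 0))) -(real_normK (num_real (v 0 1))).
have := coord_le_norm v 0; have := coord_le_norm v 1.
move: (normr_ge0 (v 0 0)) (normr_ge0 (v 0 1)).
by move: `|v 0 0| `|v 0 1| `|v| => a b c; nra.
Qed.

(** Both norms induce the same topology, so being Lipschitz for the Euclidean
    norm is enough. *)
Lemma continuous_enorm_lipschitz (f : 'rV[R]_2 -> R) :
  (forall x y, f x <= f y + enorm (x - y)) -> continuous f.
Proof.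
move=> fL x; apply/(@cvgrPdist_lt _ _ _ (nbhs x) _ f) => e e0.
have e20 : 0 < e / 2 by rewrite divr_gt0.
apply/nbhs_ballP; exists (e / 2) => // y; rewrite -ball_normE /ball_/= => xy.
have {}xy : enorm (x - y) < e.
  by apply: le_lt_trans (enorm_le_norm _) _; rewrite mulrC -ltr_pdivlMr.
rewrite ltr_distlC; have := fL x y; have := fL y x.
by rewrite (enormB y) => h1 h2; apply/andP; split; move: xy h1 h2; lra.
Qed.

Lemma continuous_enormB p : continuous (fun x => enorm (x - p)).
Proof.
apply: continuous_enorm_lipschitz => x y.
have -> : x - p = (x - y) + (y - p) by rewrite addrA subrK.
by rewrite [leRHS]addrC enormD.
Qed.

Lemma nbhs_eball p (r : R) : 0 < r -> nbhs p (eball p r).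
Proof.
move=> r0; have := @continuous_enormB p p; rewrite /continuous_at subrr enorm0.
move/(@cvgrPdist_lt _ _ _ (nbhs p)) => /(_ _ r0).
apply: (@filterS _ (nbhs p)) => x /=.
by rewrite sub0r normrN ger0_norm// enorm_ge0.
Qed.

Lemma cvg_line x v : (x + t *: v) @[t --> (0 : R)] --> x.
Proof.
have {2}-> : x = x + 0 *: v by rewrite scale0r addr0.
by apply: cvgD; [exact: cvg_cst|apply: cvgZr_tmp; exact: cvg_id].
Qed.

Lemma near_line x v (P : set 'rV[R]_2) :
  nbhs x P -> \forall t \near (0 : R), P (x + t *: v).
Proof. exact: (@cvg_line x v P). Qed.

End EuclideanPlane.

(** * The distance to the complement *)

Section DistanceToComplement.
Context {R : realType}.
Variable A : set 'rV[R]_2.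
Hypothesis (A_open : open A) (A_proper : ~` A !=set0).
Implicit Types (x y p q : 'rV[R]_2).

Definition cdist x : R := inf [set enorm (x - q) | q in ~` A].

Lemma has_inf_cdist x : has_inf [set enorm (x - q) | q in ~` A].
Proof.
split; first by case: A_proper => q Aq; exists (enorm (x - q)), q.
by exists 0 => _ [q _ <-]; exact: enorm_ge0.
Qed.

Lemma cdist_le x q : ~ A q -> cdist x <= enorm (x - q).
Proof. by move=> Aq; apply: (ge_inf (has_inf_cdist x).2); exists q. Qed.

Lemma cdist_attained x : exists2 p, ~ A p & enorm (x - p) = cdist x.
Proof.
have [q0 Aq0] := A_proper.
(* cutting off with a ball makes the closed complement compact *)
pose K := ~` A `&` [set q | enorm (q - x) <= enorm (q0 - x)].
have Kcpt : compact K.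
  apply: bounded_closed_compact.
    exists (`|x| + enorm (q0 - x)); split; first by rewrite num_real.
    move=> M KM q [_ /= qx]; apply: le_trans (ltW KM).
    rewrite -[q](subrK x) (le_trans (ler_normD _ _))// addrC lerD2l.
    exact: le_trans (norm_le_enorm _) qx.
  apply: closedI; first exact: open_closedC.
  by apply: closed_comp (@closed_le _ _) => z _; exact: continuous_enormB.
have [||p Kp pmin] := @EVT_min_rV R 2 (fun q => enorm (q - x)) K _ Kcpt.
- by exists q0; split => /=.
- by apply: continuous_subspaceT; exact: continuous_enormB.
move: Kp; rewrite inE => -[Ap /= px]; exists p => //.
apply/eqP; rewrite eq_le; apply/andP; split; last exact: cdist_le.
apply: lb_le_inf; first by exists (enorm (x - q0)), q0.
move=> _ [q Aq <-]; rewrite (enormB x p) (enormB x q).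
have [qx|/ltW qx] := leP (enorm (q - x)) (enorm (q0 - x)).
  by apply: pmin; rewrite inE.
exact: le_trans px qx.
Qed.

Lemma cdist_lipschitz x y : cdist x <= cdist y + enorm (x - y).
Proof.
have [p Ap <-] := cdist_attained y.
apply: le_trans (cdist_le x Ap) _.
have -> : x - p = (x - y) + (y - p) by rewrite addrA subrK.
by rewrite [leRHS]addrC enormD.
Qed.

Lemma continuous_cdist : continuous cdist.
Proof. exact: continuous_enorm_lipschitz cdist_lipschitz. Qed.

Lemma cdist_ge0 x : 0 <= cdist x.
Proof. by have [p _ <-] := cdist_attained x; exact: enorm_ge0. Qed.

Lemma cdist_out x : ~ A x -> cdist x = 0.
Proof.
move=> Ax; apply/eqP; rewrite eq_le cdist_ge0 andbT.
by have := cdist_le x Ax; rewrite subrr enorm0.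
Qed.

Lemma cdist_le_inradius (d : R) x : is_inradius A d -> cdist x <= d.
Proof.
move=> [_]; apply => y /=; rewrite /eball/= => yx.
apply: contrapT => Ay; move: yx; rewrite ltNge enormB.
by move=> /negP; apply; exact: cdist_le.
Qed.

(** Walking from [x] to a nearest point of the complement one stays in [A]
    until the very end, so that point adheres to [A]. *)
Lemma nearest_frontier x p :
  ~ A p -> enorm (x - p) = cdist x -> A x -> frontier A p.
Proof.
move=> Ap xp Ax; split; last first.
  by move/(@interior_subset _ A).
have xp0 : 0 < enorm (x - p).
  rewrite lt_neqAle enorm_ge0 andbT; apply/eqP => /esym/enorm_eq0/eqP.
  by rewrite subr_eq0 => /eqP xp_eq; apply: Ap; rewrite -xp_eq.
have At t : 0 < t < 1 -> A (p + t *: (x - p)).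
  move=> /andP[t0 t1]; apply: contrapT => /(cdist_le x).
  rewrite -xp (_ : x - (_ + _) = (1 - t) *: (x - p)); last first.
    by rewrite scalerBl scale1r opprD addrA.
  by rewrite enormZ gtr0_norm ?subr_gt0// leNgt gtr_pMl// gtrBl t0.
move=> B /(@near_line _ p (x - p)) Bt.
near (0 : R)^'+ => t; exists (p + t *: (x - p)); split.
  by apply: At; apply/andP; split; near: t;
    [exact: nbhs_right_gt|exact: nbhs_right_lt].
near: t; exact: cvg_within Bt.
Unshelve. all: by end_near. Qed.

End DistanceToComplement.

(** * Derivatives along lines *)

Section LineDerivatives.
Context {R : realType}.

Lemma near0_norm_lt (r : R) : 0 < r -> \forall t \near (0 : R), `|t| < r.
Proof. by move=> r0; apply/nbhs_normP; exists r => // t /=; rewrite sub0r normrN. Qed.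

(** Parametrising the segment from [0] to [t] by the unit interval treats both
    signs of [t] at once. *)
Lemma MVT0 (k dk : R -> R) (t : R) :
  (forall s : R, `|s| <= `|t| -> is_derive s (1 : R) k (dk s)) ->
  exists2 th, 0 < th < 1 & k t - k 0 = dk (th * t) * t.
Proof.
move=> kd.
have hd (s : R) : s \in `[0, 1] -> is_derive s (1 : R) (fun s => k (s * t)) (dk (s * t) * t).
  rewrite in_itv/= => /andP[s0 s1].
  apply: (@is_derive1_comp _ k (fun s => s * t)).
    by apply: kd; rewrite normrM ger0_norm// ler_piMl.
  by apply: is_derive_eq; rewrite scaler0 add0r /GRing.scale/= mulr1.
have gc : {within `[0, 1], continuous (fun s => k (s * t))}.
  by apply: derivable_within_continuous => s /hd [].
have hd' (s : R) : s \in `]0, 1[ -> is_derive s (1 : R) (fun s => k (s * t)) (dk (s * t) * t).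
  by rewrite in_itv/= => /andP[s0 s1]; apply: hd; rewrite in_itv/= !ltW.
have [th th01] := MVT ltr01 hd' gc.
by rewrite mul1r mul0r subr0 mulr1 => ->; exists th => //; move: th01; rewrite in_itv.
Qed.

Lemma is_derive_cvg (V : normedModType R) (f : V -> R) x v l :
  is_derive x v f l <->
  h^-1 * (f (x + h *: v) - f x) @[h --> 0^'] --> l.
Proof.
have E : (fun h => h^-1 *: ((f \o shift x) (h *: v) - f x)) =
         (fun h => h^-1 * (f (x + h *: v) - f x)).
  by apply/funext => h /=; rewrite (addrC x).
split=> [[+ <-]|fl]; first by rewrite /derivable /derive E.
by split; [rewrite /derivable E; apply/cvg_ex; exists l|
           rewrite /derive E; apply/cvg_lim].
Qed.

Lemma is_derive_line (V : normedModType R) (f : V -> R) x v t l :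
  is_derive (x + t *: v) v f l ->
  is_derive t (1 : R) (fun s => f (x + s *: v)) l.
Proof.
move=> /is_derive_cvg fl; apply/is_derive_cvg; apply: cvg_trans fl.
apply: near_eq_cvg; near=> h; congr (_ * (f _ - _)).
by rewrite [h *: (1 : R)]mulr1 scalerDl addrA.
Unshelve. all: by end_near. Qed.

Lemma line_is_derive (V : normedModType R) (f : V -> R) x v l :
  is_derive (0 : R) (1 : R) (fun s => f (x + s *: v)) l -> is_derive x v f l.
Proof.
move=> /is_derive_cvg fl; apply/is_derive_cvg; apply: cvg_trans fl.
apply: near_eq_cvg; near=> h; congr (_ * (f _ - f _)).
  by rewrite add0r [h *: (1 : R)]mulr1.
by rewrite scale0r addr0.
Unshelve. all: by end_near. Qed.

(** Near [0] the derivative [dk] has the sign of its argument, so [k] decreases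
    towards [0] and increases away from it. *)
Lemma second_order_strict_min (k dk : R -> R) l :
  (\forall t \near (0 : R), is_derive t (1 : R) k (dk t)) -> dk 0 = 0 ->
  is_derive (0 : R) 1 dk l -> 0 < l ->
  \forall t \near (0 : R), t != 0 -> k 0 < k t.
Proof.
move=> /nbhs_ballP[/= r r0 kd] dk0 /is_derive_cvg dkl l0.
have : \forall h \near 0^', 0 < h^-1 * dk h.
  near=> h; have : 0 < h^-1 * (dk (0 + h *: (1 : R)) - dk 0).
    by near: h; apply: cvgr_gt l0; exact: dkl.
  by rewrite dk0 subr0 add0r [h *: (1 : R)]mulr1.
move=> /nbhs_ballP[/= r' r'0 dkpos].
near=> t => t0.
have tr : `|t| < r by near: t; exact: near0_norm_lt.
have tr' : `|t| < r' by near: t; exact: near0_norm_lt.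
have [s st|th /andP[th0 th1] E] := @MVT0 k dk t.
  by apply: kd; rewrite -ball_normE/= sub0r normrN (le_lt_trans st).
rewrite -subr_gt0 E.
have tht0 : th * t != 0 by rewrite mulf_neq0// gt_eqF.
have := dkpos (th * t); rewrite -ball_normE/= sub0r normrN.
move=> /(_ _ tht0); rewrite normrM gtr0_norm//.
have h : th * `|t| < r' by rewrite (le_lt_trans _ tr')// ler_piMl// ltW.
move=> /(_ h) {}h.
have : 0 < (th * t)^-1 * dk (th * t) * (th * t ^+ 2).
  by rewrite mulr_gt0// mulr_gt0// exprn_even_gt0.
congr (0 < _); field; apply/andP; split => //; by rewrite gt_eqF.
Unshelve. all: by end_near. Qed.

Lemma local_min_test (k dk : R -> R) l :
  (\forall t \near (0 : R), is_derive t (1 : R) k (dk t)) ->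
  is_derive (0 : R) 1 dk l -> (\forall t \near (0 : R), k 0 <= k t) ->
  dk 0 = 0 /\ 0 <= l.
Proof.
move=> kd dkl kmin.
have dk0 : dk 0 = 0.
  have k0 := nbhs_singleton kd.
  move: kd kmin => /nbhs_ballP[/= r r0 kd] /nbhs_ballP[/= r' r'0 kmin].
  pose e := Num.min r r' / 2.
  have e0 : 0 < e by rewrite divr_gt0// lt_min r0.
  have er (t : R) : t \in `]- e, e[ -> `|t| < r /\ `|t| < r'.
    rewrite in_itv/= -ltr_norml => te; apply/andP; rewrite -lt_min.
    by rewrite (lt_trans te)// /e gtr_pMr ?lt_min ?r0// invf_lt1 ?ltr1n.
  have [||||_ k'0] := @derive1_at_min _ k (- e) e 0.
  - by rewrite ltW// gtrN.
  - move=> t /er[tr _]; apply: ex_derive; apply: kd.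
    by rewrite -ball_normE/= sub0r normrN.
  - by rewrite in_itv/= oppr_lt0 e0.
  - move=> t /er[_ tr]; apply: kmin.
    by rewrite -ball_normE/= sub0r normrN.
  by have [_ <-] := k0; exact: k'0.
split => //; rewrite leNgt; apply/negP => l0.
(* otherwise [- k] would have a strict local minimum as well *)
have /nbhs_ballP[/= r r0 kr] :
    \forall t \near (0 : R), t != 0 -> - k 0 < - k t.
  have Nk0 : - dk 0 = 0 by rewrite dk0 oppr0.
  apply: (@second_order_strict_min (- k) (- dk) (- l)) => //.
    by apply: filterS kd => t ht; exact: is_deriveN.
  by rewrite oppr_gt0.
move: kmin => /nbhs_ballP[/= r' r'0 kr'].
near (0 : R)^'+ => t.
have t0 : 0 < t by near: t; exact: nbhs_right_gt.
have := kr t; have := kr' t; rewrite -!ball_normE/= !sub0r !normrN gtr0_norm//.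
have -> : t < r' by near: t; exact: nbhs_right_lt.
have -> : t < r by near: t; exact: nbhs_right_lt.
move=> /(_ isT) a /(_ isT) b; have := b (lt0r_neq0 t0).
by rewrite ltrN2 ltNge a.
Unshelve. all: by end_near. Qed.

Lemma MVT_line (V : normedModType R) (f : V -> R) y v (t : R) :
  (forall s : R, `|s| <= `|t| -> derivable f (y + s *: v) v) ->
  exists2 th : R, 0 < th < 1 & f (y + t *: v) - f y = 'D_v f (y + (th * t) *: v) * t.
Proof.
move=> fd.
have [s st|th th01] := @MVT0 (fun s => f (y + s *: v))
    (fun s => 'D_v f (y + s *: v)) t.
  by apply: is_derive_line; apply: derivableP; exact: fd.
by rewrite scale0r addr0; exists th.
Qed.

Lemma enorm_e (i : 'I_2) : enorm ('e_i : 'rV[R]_2) = 1.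
Proof.
rewrite /enorm dotE !mxE/=.
by case: i => -[|[|//]] ? /=; rewrite ?(mulr1, mulr0, addr0, add0r) sqrtr1.
Qed.

Lemma row2_sum (v : 'rV[R]_2) : v = v 0 0 *: 'e_0 + v 0 1 *: 'e_1.
Proof. by apply: row2P; rewrite !mxE/= ?(mulr1, mulr0, addr0, add0r). Qed.

(** Increments are taken along one coordinate at a time, each expressed by the
    mean value theorem; continuity of the partial derivatives lets the
    intermediate points tend to [x]. *)
Lemma is_derive_dir (f : 'rV[R]_2 -> R) (x v : 'rV[R]_2) :
  (\forall y \near x, forall i : 'I_2, derivable f y 'e_i) ->
  (forall i : 'I_2, {for x, continuous (partial i f)}) ->
  is_derive x v f (v 0 0 * partial 0 f x + v 0 1 * partial 1 f x).
Proof.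
move=> fd fc; apply/is_derive_cvg/cvgrPdist_le => e e0.
pose c := `|v 0 0| + `|v 0 1| + 1.
have c0 : 0 < c by rewrite ltr_wpDl// addr_ge0.
pose e' := e / c.
have e'0 : 0 < e' by rewrite divr_gt0.
have fc' i := (@cvgrPdist_le _ _ _ (nbhs x) (nbhs_filter x) _ _).1 (fc i) e' e'0.
have /nbhs_ballP[/= r r0 rP] := @filterI _ (nbhs x) (nbhs_filter x) _ _ (fc' 0)
   (@filterI _ (nbhs x) (nbhs_filter x) _ _ (fc' 1) fd).
have {rP} Pr z : enorm z < r ->
   `|partial 0 f x - partial 0 f (x + z)| <= e' /\
   `|partial 1 f x - partial 1 f (x + z)| <= e' /\
   forall i : 'I_2, derivable f (x + z) 'e_i.
  move=> zr; apply: rP; rewrite -ball_normE/= opprD addNKr normrN.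
  exact: le_lt_trans (norm_le_enorm _) zr.
(* the step [h *: v] is taken first along ['e_0], then along ['e_1] *)
near=> h.
have h0 : h != 0 by near: h; exact: nbhs_dnbhs_neq.
have hr : `|h| * c < r.
  by rewrite -ltr_pdivlMr//; near: h; apply: dnbhs0_lt; rewrite divr_gt0.
have small (s0 s1 : R) : `|s0| <= `|h * v 0 0| -> `|s1| <= `|h * v 0 1| ->
    enorm (s0 *: 'e_0 + s1 *: 'e_1) < r.
  move=> s0h s1h; apply: le_lt_trans (enormD _ _) _.
  rewrite !enormZ !enorm_e !mulr1; apply: le_lt_trans (lerD s0h s1h) _.
  by apply: le_lt_trans hr; rewrite !normrM -mulrDr ler_wpM2l// lerDl.
have [s sh|t0 /andP[t00 t01] E0] := @MVT_line _ f x 'e_0 (h * v 0 0).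
  have := small s 0 sh; rewrite normr0 scale0r addr0 => /(_ (normr_ge0 _)) sr.
  by have [_ [_]] := Pr _ sr; exact.
have [s sh|t1 /andP[t10 t11] E1] := @MVT_line _ f (x + (h * v 0 0) *: 'e_0) 'e_1 (h * v 0 1).
  have sr := small _ s (lexx _) sh.
  by have [_ [_]] := Pr _ sr; rewrite addrA; exact.
have le1 (t a : R) : 0 < t -> t < 1 -> `|t * a| <= `|a|.
  by move=> t_0 t_1; rewrite normrM gtr0_norm// ler_piMl// ltW.
have := Pr _ (small (t0 * (h * v 0 0)) 0 (le1 _ _ t00 t01) _).
rewrite normr0 scale0r addr0 => /(_ (normr_ge0 _))[D0 _].
have := Pr _ (small _ (t1 * (h * v 0 1)) (lexx _) (le1 _ _ t10 t11)).
rewrite addrA => -[_ [D1 _]].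
have -> : f (x + h *: v) - f x =
   partial 1 f (x + (h * v 0 0) *: 'e_0 + (t1 * (h * v 0 1)) *: 'e_1) * (h * v 0 1)
   + partial 0 f (x + (t0 * (h * v 0 0)) *: 'e_0) * (h * v 0 0).
  rewrite /partial -E0 -E1 {1}(row2_sum v) scalerDr !scalerA addrA.
  by rewrite addrA subrK.
move: (partial 1 f (_ + _)) (partial 0 f (_ + _)) D0 D1 => p1 p0 D0 D1.
have -> : v 0 0 * partial 0 f x + v 0 1 * partial 1 f x -
   h^-1 * (p1 * (h * v 0 1) + p0 * (h * v 0 0)) =
   v 0 0 * (partial 0 f x - p0) + v 0 1 * (partial 1 f x - p1) by field.
apply: le_trans (ler_normD _ _) _; rewrite !normrM.
have -> : e = c * e' by rewrite /e' mulrC divfK// gt_eqF.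
apply: (@le_trans _ _ (`|v 0 0| * e' + `|v 0 1| * e')).
  by apply: lerD; rewrite ler_wpM2l.
by rewrite -mulrDl ler_pM2r// lerDl.
Unshelve. all: by end_near. Qed.
End LineDerivatives.

(** * Strict convexity near a boundary point *)

Section BoundaryChart.
Context {R : realType}.
Implicit Types (A : set 'rV[R]_2) (p e v w : 'rV[R]_2).

Lemma smooth_is_derive (f : R -> R) n t :
  smooth_curve f -> is_derive t (1 : R) f^`(n)%classic (f^`(n.+1)%classic t).
Proof. by move=> fs; rewrite derive1nS derive1E; apply: derivableP; exact: fs. Qed.

Lemma is_derive_scalel (V : normedModType R) (f : R -> R) (w : V) t l :
  is_derive t (1 : R) f l -> is_derive t (1 : R) (fun s => f s *: w) (l *: w).
Proof.
move=> [fd <-].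
have H : (fun h : R => h^-1 *: (((fun s => f s *: w) \o shift t) (h *: (1 : R)) - f t *: w))
   @ 0^' --> 'D_1 f t *: w.
  rewrite (_ : (fun h : R => _) =
     (fun h : R => (h^-1 *: ((f \o shift t) (h *: (1 : R)) - f t)) *: w)).
    exact: cvgZr_tmp.
  by apply/funext => h /=; rewrite -scalerBl scalerA.
by split; [apply/cvg_ex; eexists; exact: H|apply/cvg_lim].
Qed.

Section Graph.
Variables (p e : 'rV[R]_2) (f : R -> R).
Hypotheses (e1 : enorm e = 1) (fs : smooth_curve f).

Definition graph_curve (s : R) := p + s *: e + f s *: rot90 e.

Lemma unit_sqr : e 0 0 ^+ 2 + e 0 1 ^+ 2 = 1.
Proof. by rewrite !expr2 -dotE -sqr_enorm e1 expr1n. Qed.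

Lemma derive1_graph_curve :
  (forall t, derivable graph_curve t 1) /\
  graph_curve^`()%classic = (fun s => e + f^`()%classic s *: rot90 e).
Proof.
have H t : is_derive t (1 : R) graph_curve (e + f^`()%classic t *: rot90 e).
  have h1 := is_derive_scalel e (is_derive_id t (1 : R)).
  have h2 := is_derive_scalel (rot90 e) (smooth_is_derive 0 t fs).
  apply: (is_derive_eq (is_deriveD (is_deriveD (is_derive_cst p t (1 : R)) h1) h2)).
  by rewrite add0r scale1r derive1n1.
split=> [t|]; first by have [] := H t.
by apply/funext => t; rewrite derive1E; have [] := H t.
Qed.

Lemma derive1n_graph_curve n : (forall t, derivable (graph_curve^`(n.+1)%classic) t 1) /\
  graph_curve^`(n.+2)%classic = (fun s => f^`(n.+2)%classic s *: rot90 e).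
Proof.
elim: n => [|n [_ IH]].
  have H t : is_derive t (1 : R) graph_curve^`()%classic (f^`(2)%classic t *: rot90 e).
    rewrite derive1_graph_curve.2.
    have h2 := is_derive_scalel (rot90 e) (smooth_is_derive 1 t fs).
    by apply: (is_derive_eq (is_deriveD (is_derive_cst e t (1 : R)) h2)); rewrite add0r.
  rewrite derive1n1; split=> [t|]; first by have [] := H t.
  by apply/funext => t; rewrite derive1nS derive1n1 derive1E; have [] := H t.
have H t : is_derive t (1 : R) graph_curve^`(n.+2)%classic (f^`(n.+3)%classic t *: rot90 e).
  by rewrite IH; apply: is_derive_scalel; exact: smooth_is_derive.
split=> [t|]; first by have [] := H t.
by apply/funext => t; rewrite derive1nS derive1E; have [] := H t.
Qed.

Lemma smooth_graph_curve : smooth_curve graph_curve.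
Proof.
by case=> [t|n t]; [exact: derive1_graph_curve.1|exact: (derive1n_graph_curve n).1].
Qed.

(** The curvature of a graph is [f'' / (1 + f' ^ 2) ^ (3 / 2)], so it has the
    sign of [f'']. *)
Lemma signed_curvature_graph :
  0 < signed_curvature graph_curve 0 -> 0 < f^`(2)%classic 0.
Proof.
rewrite /signed_curvature (derive1n_graph_curve 0).2 derive1_graph_curve.2.
have -> : dot (rot90 (e + f^`()%classic 0 *: rot90 e))
    (f^`(2)%classic 0 *: rot90 e) = f^`(2)%classic 0.
  rewrite dotE !rot90E0 !rot90E1 !mxE/= -[RHS]mulr1 -unit_sqr; ring.
apply: contraTT; rewrite -!leNgt => f2; rewrite mulr_le0_ge0// invr_ge0 exprn_ge0//.
exact: enorm_ge0.
Qed.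

End Graph.

(** At a boundary point the inward curvature of the local graph is positive, so
    the graph stays above its tangent line: a segment of that line centred at
    the boundary point avoids the domain. *)
Lemma tangent_segment A p :
  open A -> smooth_boundary A -> strictly_convex A -> frontier A p ->
  exists2 v, v != 0 & \forall s \near (0 : R), ~ A (p + s *: v).
Proof.
move=> Aopen Asm Acv Ap.
have [e [f [r [e1 fs r0 chart]]]] := Asm p Ap.
have ee := unit_sqr e1.
have rot1 : enorm (rot90 e) = 1.
  by rewrite -e1 /enorm !dotE rot90E0 rot90E1 mulrNN addrC.
(* the chart read in the coordinates [a, b] of the frame [e, rot90 e] *)
have nchart a b : `|a| + `|b| < r -> (A (p + (a *: e + b *: rot90 e)) <-> f a < b).
  move=> abr; rewrite chart; last first.
    rewrite /eball/= addrC addKr (le_lt_trans (enormD _ _))//.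
    by rewrite !enormZ e1 rot1 !mulr1.
  rewrite [p + _]addrC addrK.
  have -> : dot (a *: e + b *: rot90 e) e = a.
    rewrite dotE !mxE/= -[RHS]mulr1 -ee; ring.
  have -> // : dot (a *: e + b *: rot90 e) (rot90 e) = b.
  rewrite dotE !mxE/= -[RHS]mulr1 -ee; ring.
have nAp : ~ A p by move=> Ap'; apply: Ap.2; rewrite (interior_id _).1.
have fd t : is_derive t (1 : R) f (f^`()%classic t).
  by have := smooth_is_derive 0 t fs; rewrite derive1n1.
have fc : continuous f.
  by move=> t; apply/differentiable_continuous/derivable1_diffP; have [] := fd t.
(* [p] itself is on the graph: otherwise a neighbourhood of [p] would be
   contained in the domain or in its complement *)
have f0 : f 0 = 0.
  apply/eqP; rewrite eq_le; apply/andP; split; last first.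
    rewrite leNgt; apply/negP => f0; apply: nAp.
    have [|_] := nchart 0 0; first by rewrite normr0 addr0.
    by rewrite !scale0r !addr0; apply.
  rewrite leNgt; apply/negP => f0.
  have f20 : 0 < f 0 / 2 by rewrite divr_gt0.
  have f2f : f 0 / 2 < f 0 by rewrite ltr_pdivrMr// ltr_pMr// ltr1n.
  have /nbhs_ballP[/= r' r'0 fr'] : \forall t \near (0 : R), f 0 / 2 < f t.
    exact: (cvgr_gt _ (fc 0) _ f2f).
  have m0 : 0 < Num.min r (Num.min r' (f 0 / 2)) by rewrite !lt_min r0 r'0.
  have [x [Ax]] := Ap.1 _ (nbhs_eball p m0).
  rewrite /eball/= !lt_min => /and3P[xr xr' xf].
  have /chart := xr => /iffLR /(_ Ax).
  have d1 : `|dot (x - p) e| <= enorm (x - p).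
    have := dot_le_enorm (x - p) e; have := dot_le_enorm (p - x) e.
    rewrite e1 !mulr1 (enormB p) (_ : dot (p - x) e = - dot (x - p) e).
      by move=> h1 h2; rewrite ler_norml lerNl h1 h2.
    by rewrite !dotE !mxE; ring.
  have d2 : dot (x - p) (rot90 e) <= enorm (x - p).
    by rewrite (le_trans (dot_le_enorm _ _))// rot1 mulr1.
  have := fr' (dot (x - p) e).
  rewrite -ball_normE/= sub0r normrN (le_lt_trans d1 xr') => /(_ isT) h1 h2.
  by have := lt_trans (lt_trans h1 h2) (le_lt_trans d2 xf); rewrite ltxx.
have gE s c : graph_curve p e f s + c *: rot90 e
    = p + (s *: e + (f s + c) *: rot90 e).
  by rewrite /graph_curve scalerDl !addrA.
have fr_near : \forall s \near (0 : R), frontier A (graph_curve p e f s).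
  near=> s.
  have sr : `|s| + `|f s| < r.
    have s2 : `|s| < r / 2 by near: s; apply: near0_norm_lt; rewrite divr_gt0.
    have fs2 : `|f s| < r / 2.
      near: s; apply: cvgr0_norm_lt; last by rewrite divr_gt0.
      by have := fc 0; rewrite /continuous_at f0.
    by rewrite (splitr r) ltrD.
  split; last first.
    move=> /interior_subset; have := gE s 0.
    rewrite scale0r !addr0 => ->.
    by rewrite nchart// ltxx.
  move=> B /(@near_line _ _ (rot90 e)) Bt.
  near (0 : R)^'+ => h; exists (graph_curve p e f s + h *: rot90 e); split; last first.
    by near: h; exact: cvg_within Bt.
  have h0 : 0 < h by near: h; exact: nbhs_right_gt.
  rewrite gE nchart ?ltrDl//.
  apply: (@le_lt_trans _ _ (`|s| + `|f s| + h)).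
    by rewrite -addrA lerD2l (le_trans (ler_normD _ _))// (gtr0_norm h0).
  rewrite addrC -ltrBrDr; near: h; apply: nbhs_right_lt.
  by rewrite subr_gt0.
set f1 := f^`()%classic 0.
have tangent_neq0 : e + f1 *: rot90 e != 0.
  apply/negP => /eqP v0.
  have : dot (e + f1 *: rot90 e) e = 1.
    rewrite dotE !mxE/= -ee; ring.
  by rewrite v0 dotE !mxE !mul0r addr0 => /esym/eqP; rewrite oner_eq0.
(* a step [h] along the normal clears the graph by [h - f (- f1 * h)], whose
   derivative at [0] is [1 + f1 ^+ 2] *)
have inward : \forall h \near (0 : R)^'+,
    A (p + h *: rot90 ((graph_curve p e f)^`()%classic 0)).
  rewrite (derive1_graph_curve p e fs).2 -/f1.
  have -> : rot90 (e + f1 *: rot90 e) = (- f1) *: e + rot90 e.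
    by apply: row2P; rewrite !(rot90E0, rot90E1, mxE)/=; ring.
  have kd : is_derive (0 : R) (1 : R) (fun h : R => h - f (- f1 * h)) (1 + f1 ^+ 2).
    have fd0 : is_derive (- f1 * 0) (1 : R) f f1 by rewrite mulr0; exact: fd.
    have ld : is_derive (0 : R) (1 : R) (fun h : R => - f1 * h) (- f1).
      have -> : (fun h : R => - f1 * h) = (- f1) *: (id : R -> R) by [].
      by apply: is_derive_eq; rewrite /GRing.scale/= mulr1.
    have := is_derive1_comp (f := f) (g := fun h => - f1 * h) fd0 ld => cd.
    have -> : (fun h : R => h - f (- f1 * h)) = id - (f \o (fun h : R => - f1 * h)) by [].
    by apply: is_derive_eq; rewrite mulrN opprK expr2.
  have k0 : 0 < 1 + f1 ^+ 2 by rewrite ltr_wpDr// sqr_ge0.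
  move/is_derive_cvg/cvg_dnbhs_at_right : kd => kd.
  have {}kd : \forall h \near (0 : R)^'+,
      0 < h^-1 * (0 + h *: (1 : R) - f (- f1 * (0 + h *: (1 : R))) - (0 - f (- f1 * 0))).
    exact: (cvgr_gt _ kd _ k0).
  near=> h.
  have h0 : 0 < h by near: h; exact: nbhs_right_gt.
  have : 0 < h^-1 * (0 + h *: (1 : R) - f (- f1 * (0 + h *: (1 : R))) - (0 - f (- f1 * 0))).
    by near: h.
  rewrite add0r [h *: (1 : R)]mulr1 mulr0 f0 subrr subr0 pmulr_rgt0 ?invr_gt0// subr_gt0.
  rewrite scalerDr scalerA => hf.
  apply/nchart; last by rewrite mulrC.
  rewrite -{2}[h]mulr1 !normrM -mulrDr gtr0_norm// -ltr_pdivlMr; last first.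
    by rewrite normr1 ltr_wpDl.
  near: h; apply: nbhs_right_lt; rewrite divr_gt0// normr1 ltr_wpDl//.
have f2 : 0 < f^`(2)%classic 0.
  apply: (@signed_curvature_graph p e f e1 fs); apply: (Acv p _ Ap).
  exists (graph_curve p e f), 0; split; split => //.
  - exact: smooth_graph_curve.
  - by rewrite /graph_curve f0 !scale0r !addr0.
  - by rewrite (derive1_graph_curve p e fs).2.
exists (e + f1 *: rot90 e) => //.
have fpos : \forall t \near (0 : R), t != 0 -> f 0 - 0 * f1 < f t - t * f1.
  apply: (@second_order_strict_min _ (fun t => f t - t * f1)
    (fun t => f^`()%classic t - f1) (f^`(2)%classic 0)).
  - near=> t; have ld := is_derive_scalel (f1 : R^o) (is_derive_id t (1 : R)).
    by apply: (is_derive_eq (is_deriveB (fd t) ld)); rewrite [_ *: _]mul1r.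
  - by rewrite subrr.
  - have := smooth_is_derive 1 0 fs; rewrite derive1n1 => d1.
    by apply: (is_derive_eq (is_deriveB d1 (is_derive_cst f1 0 (1 : R)))); rewrite subr0.
  - exact: f2.
near=> s.
rewrite scalerDr scalerA nchart.
  apply/negP; rewrite -leNgt.
  have [->|s0] := eqVneq s 0; first by rewrite f0 mul0r.
  rewrite -subr_ge0 ltW//.
  have : s != 0 -> f 0 - 0 * f1 < f s - s * f1 by near: s.
  by rewrite f0 mul0r subrr; exact.
rewrite -{1}[s]mulr1 !normrM -mulrDr -ltr_pdivlMr; last by rewrite normr1 ltr_wpDr.
near: s; apply: near0_norm_lt; rewrite divr_gt0// normr1 ltr_wpDr//.
Unshelve. all: by end_near. Qed.

End BoundaryChart.

(** * The one-dimensional barrier *)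

Section Barrier.
Context {R : realType}.
Variable a : R.
Hypothesis a1 : 1 < a.
Implicit Types y : R.

(** One-dimensional solutions satisfy
    [(1 + u' ^ 2) ^ ((a - 1) / 2) = 1 + (a - 1) * (u - min u)]; in terms of the
    slope angle [y], given by [u' = tan y], this reads [u - min u = barrier y].
    Along the solution [y' = cos y `^ (a - 1) <= 1], so using [y] itself as the
    space variable yields a steeper profile, which is a subsolution. *)
Definition barrier y : R := (a - 1)^-1 * (cos y `^ (1 - a) - 1).
Definition dbarrier y : R := cos y `^ (- a) * sin y.
Definition ddbarrier y : R :=
  cos y `^ (- a - 1) * (a * sin y ^+ 2 + cos y ^+ 2).

Lemma is_derive_barrier y : 0 < cos y -> is_derive y (1 : R) barrier (dbarrier y).
Proof.
move=> cy.
have h := is_derive1_comp (is_derive1_powR (1 - a) cy) (is_derive_cos y).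
have -> : barrier = (a - 1)^-1 *: (((fun z : R => z `^ (1 - a)) \o cos) - cst 1) by [].
apply: is_derive_eq; rewrite subr0 /dbarrier /GRing.scale/=.
rewrite (_ : 1 - a - 1 = - a); last by ring.
by field; rewrite subr_eq0 gt_eqF.
Qed.

Lemma is_derive_dbarrier y :
  0 < cos y -> is_derive y (1 : R) dbarrier (ddbarrier y).
Proof.
move=> cy.
have h := is_derive1_comp (is_derive1_powR (- a) cy) (is_derive_cos y).
have -> : dbarrier = ((fun z : R => z `^ (- a)) \o cos) * sin by [].
apply: is_derive_eq; rewrite /ddbarrier /GRing.scale/=.
have -> : cos y `^ (- a) = cos y `^ (- a - 1) * cos y.
  rewrite powRB; last by rewrite (gt_eqF cy) implybT.
  by rewrite powRr1 ?ltW// divfK// gt_eqF.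
by ring.
Qed.

Lemma barrier_le y z : 0 <= y -> y <= z -> z < pi / 2 -> barrier y <= barrier z.
Proof.
move=> y0 yz zpi; rewrite /barrier ler_wpM2l ?invr_ge0 ?subr_ge0 ?(ltW a1)//.
have cz : 0 < cos z by apply: cos_gt0_pihalf; rewrite zpi andbT; have := pi_gt0 R; lra.
have czy : cos z <= cos y.
  by rewrite leNgt ltr_cos ?in_itv/= -?leNgt//; apply/andP; split;
    have := pi_gt0 R; lra.
have cy : 0 < cos y := lt_le_trans cz czy.
rewrite lerD2r (_ : 1 - a = - (a - 1)); last by ring.
rewrite !powRN lef_pV2 ?posrE ?powR_gt0//.
by rewrite ge0_ler_powR// ?nnegrE ?subr_ge0 ltW.
Qed.

(** With [c = cos y], the slope satisfies [1 + dbarrier y ^+ 2 <= c `^ (- 2 a)],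
    that is [c `^ a <= s], while [c `^ (- a - 1) < ddbarrier y]; for [a < 3] the
    powers compare because [a * (3 - a) <= a + 1] amounts to
    [0 <= (a - 1) ^+ 2], and for [3 <= a] because [s <= 1]. *)
Lemma barrier_strict y (s := (Num.sqrt (1 + dbarrier y ^+ 2))^-1) :
  0 < y < pi / 2 -> s `^ a < s ^+ 3 * ddbarrier y.
Proof.
move=> /andP[y0 ypi].
have pi0 := pi_gt0 R.
set c := cos y.
have c0 : 0 < c by apply: cos_gt0_pihalf; rewrite ypi andbT; lra.
have S : sin y ^+ 2 = 1 - c ^+ 2 by rewrite -sin2cos2.
have sy : 0 < sin y by apply: sin_gt0_pi; rewrite y0/=; lra.
have c1 : c < 1.
  have : 0 < sin y ^+ 2 by rewrite exprn_gt0.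
  by rewrite S subr_gt0 -[ltRHS](expr1n R 2) ltr_pXn2r// nnegrE ?ler01 // ltW.
have c01 : 0 < c <= 1 by rewrite c0 ltW.
have Q0 : 0 < 1 + dbarrier y ^+ 2 by rewrite ltr_wpDr// sqr_ge0.
have s0 : 0 < s by rewrite invr_gt0 sqrtr_gt0.
have s1 : s <= 1.
  rewrite invf_le1 ?sqrtr_gt0// -[leLHS](sqrtr1 R) ler_sqrt ?lerDl ?sqr_ge0 ?(ltW Q0)//.
have sc : c `^ a <= s.
  rewrite -[leLHS]invrK lef_pV2 ?posrE ?invr_gt0 ?powR_gt0 ?sqrtr_gt0//.
  rewrite -powRN -[leRHS](@ger0_norm _ _ (powR_ge0 _ _)) -sqrtr_sqr ler_sqrt ?sqr_ge0//.
  rewrite /dbarrier exprMn S -/c mulrBr mulr1.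
  rewrite addrC -[leRHS]addr0 -addrA lerD2l addrC subr_le0.
  rewrite powRN exprVn mulrC -ler_pdivrMr ?invr_gt0 ?exprn_gt0 ?powR_gt0//.
  rewrite invrK mul1r ler_pXn2r ?nnegrE ?powR_ge0 ?(ltW c0)//.
  by apply: ge1r_powR => //; rewrite ltW.
have key : s `^ (a - 3) <= c `^ (- a - 1).
  have ca1 : 1 <= c `^ (- a - 1).
    have h : - a - 1 <= 0 by move: a1; lra.
    by have := ger_powR c01 h; rewrite powRr0.
  have [a3|a3] := leP 3 a.
    have s01 : 0 < s <= 1 by rewrite s0 s1.
    have h : 0 <= a - 3 by rewrite subr_ge0.
    by apply: le_trans ca1; have := ger_powR s01 h; rewrite powRr0.
  apply: (@le_trans _ _ (c `^ (a * (a - 3)))).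
    rewrite powRrM -[a - 3]opprB !powRN lef_pV2 ?posrE ?powR_gt0//.
    apply: ge0_ler_powR; rewrite ?nnegrE ?powR_ge0 ?(ltW s0)//.
    by rewrite subr_ge0 ltW.
  by apply: ger_powR => //; move: a1; nra.
have dd : c `^ (- a - 1) < ddbarrier y.
  rewrite /ddbarrier -/c ltr_pMr ?powR_gt0// S.
  have : 0 < (a - 1) * (1 - c ^+ 2) by rewrite -S mulr_gt0 ?subr_gt0// exprn_gt0.
  lra.
have -> : s `^ a = s ^+ 3 * s `^ (a - 3).
  rewrite -powR_mulrn ?ltW// -powRD; last by rewrite (gt_eqF s0) implybT.
  by congr (_ `^ _); ring.
by rewrite ltr_pM2l ?exprn_gt0// (le_lt_trans key).
Qed.

End Barrier.

(** * Touching a solution from below *)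

Section Solutions.
Context {R : realType}.
Implicit Types (A : set 'rV[R]_2) (u : 'rV[R]_2 -> R) (x v n p : 'rV[R]_2).

Lemma continuous_partials A u s x : open A -> smooth_upto_closure A u -> A x ->
  {for x, continuous (partials s u)}.
Proof.
move=> Ao [_ /(_ s)[_ [g [gc gE]]]] Ax.
have gcx : {for x, continuous g}.
  move/(continuous_subspaceW (@subset_closure _ A)) : gc.
  by rewrite continuous_open_subspace// => /(_ x); apply; rewrite inE.
rewrite /prop_for /continuous_at -gE//.
have xA : nbhs x A by exact: open_nbhs_nbhs.
apply: cvg_trans gcx; apply: (@near_eq_cvg _ _ (nbhs x) (nbhs_filter x)).
exact: (@filterS _ (nbhs x) (nbhs_filter x) A _ gE xA).
Qed.

Lemma is_derive_partials A u s x v : open A -> smooth_upto_closure A u -> A x ->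
  is_derive x v (partials s u)
    (v 0 0 * partials (0 :: s) u x + v 0 1 * partials (1 :: s) u x).
Proof.
move=> Ao us Ax; apply: is_derive_dir => [|i]; last first.
  exact: (@continuous_partials _ _ (i :: s) _ Ao us Ax).
have : nbhs x A by exact: open_nbhs_nbhs.
apply: (@filterS _ (nbhs x) (nbhs_filter x)) => y Ay i.
exact: (us.2 s).1.
Qed.

(** The second derivative of [u] at [x] along [v], expanded in coordinates. *)
Definition hess u x v : R :=
  v 0 0 * (v 0 0 * partials [:: 0; 0] u x + v 0 1 * partials [:: 1; 0] u x) +
  v 0 1 * (v 0 0 * partials [:: 0; 1] u x + v 0 1 * partials [:: 1; 1] u x).

Lemma is_derive_line1 A u x v : open A -> smooth_upto_closure A u -> A x ->
  \forall t \near (0 : R),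
    is_derive t (1 : R) (fun t => u (x + t *: v)) (dot v (grad u (x + t *: v))).
Proof.
move=> Ao us Ax.
have /(@near_line _ x v) : nbhs x A by exact: open_nbhs_nbhs.
apply: filterS => t At; apply: is_derive_line.
have := @is_derive_partials A u [::] (x + t *: v) v Ao us At.
by rewrite dotE !mxE.
Qed.

Lemma is_derive_line2 A u x v : open A -> smooth_upto_closure A u -> A x ->
  is_derive (0 : R) (1 : R) (fun t => dot v (grad u (x + t *: v))) (hess u x v).
Proof.
move=> Ao us Ax.
have H i : is_derive (0 : R) (1 : R) (fun t => partials [:: i] u (x + t *: v))
    (v 0 0 * partials [:: 0; i] u x + v 0 1 * partials [:: 1; i] u x).
  apply: is_derive_line; rewrite scale0r addr0.
  exact: (@is_derive_partials A u [:: i] x v Ao us Ax).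
have -> : (fun t => dot v (grad u (x + t *: v))) =
  (v 0 0 *: (fun t => partials [:: 0] u (x + t *: v))) +
  (v 0 1 *: (fun t => partials [:: 1] u (x + t *: v))).
  by apply/funext => t; rewrite dotE !mxE.
exact: (is_deriveD (is_deriveZ (v 0 0) (H 0)) (is_deriveZ (v 0 1) (H 1))).
Qed.

(** The flux [s *: grad u] restricted to a line, as a product of real functions:
    the derivative of [s = (1 + g0 ^+ 2 + g1 ^+ 2) `^ (- 1 / 2)] is
    [- s ^+ 3 * (g0 * g0' + g1 * g1')]. *)
Lemma is_derive_flux (g0 g1 h : R -> R) d0 d1 dh
    (s := (Num.sqrt (1 + (g0 0 ^+ 2 + g1 0 ^+ 2)))^-1) :
  is_derive (0 : R) (1 : R) g0 d0 -> is_derive (0 : R) (1 : R) g1 d1 ->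
  is_derive (0 : R) (1 : R) h dh ->
  is_derive (0 : R) (1 : R)
    (fun t => (Num.sqrt (1 + (g0 t ^+ 2 + g1 t ^+ 2)))^-1 * h t)
    (s * dh - s ^+ 3 * (g0 0 * d0 + g1 0 * d1) * h 0).
Proof.
move=> h0 h1 hh.
pose Q (t : R) := 1 + (g0 t ^+ 2 + g1 t ^+ 2).
have Q0 : 0 < Q 0 by rewrite ltr_wpDr// addr_ge0// sqr_ge0.
have hQ : is_derive (0 : R) (1 : R) Q (2 * g0 0 * d0 + 2 * g1 0 * d1).
  apply: (is_derive_eq (is_deriveD (is_derive_cst (1 : R) (0 : R) (1 : R))
    (is_deriveD (is_deriveX 2 h0) (is_deriveX 2 h1)))).
  by rewrite add0r /GRing.scale/= !expr1.
have hS := @is_derive1_comp _ Num.sqrt Q 0 _ _ (is_derive1_sqrt Q0) hQ.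
have sQ0 : (Num.sqrt \o Q) 0 != 0 by rewrite /= gt_eqF// sqrtr_gt0.
have hV := is_deriveV sQ0 hS.
apply: (is_derive_eq (is_deriveM hV hh)).
rewrite /s /GRing.scale/= -/(Q 0).
move: sQ0; rewrite /=; move: (Num.sqrt (Q 0)) => r r0.
by field.
Qed.

Lemma sqr_enorm_grad u x : enorm (grad u x) ^+ 2 = partial 0 u x ^+ 2 + partial 1 u x ^+ 2.
Proof. by rewrite sqr_enorm dotE !mxE !expr2. Qed.

Lemma div_flux A u x : open A -> smooth_upto_closure A u -> A x ->
  let s := slope_factor u x in let g i := partial i u x in
  let a i j := partials [:: i; j] u x in
  div (fun y => slope_factor u y *: grad u y) x =
  (s * a 0 0 - s ^+ 3 * (g 0 * a 0 0 + g 1 * a 0 1) * g 0) +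
  (s * a 1 1 - s ^+ 3 * (g 0 * a 1 0 + g 1 * a 1 1) * g 1).
Proof.
move=> Ao us Ax s g a.
have H i : partial i (fun y => (slope_factor u y *: grad u y) 0 i) x =
    s * a i i - s ^+ 3 * (g 0 * a i 0 + g 1 * a i 1) * g i.
  have hj j : is_derive (0 : R) (1 : R) (fun t => partial j u (x + t *: 'e_i)) (a i j).
    apply: is_derive_line; rewrite scale0r addr0.
    exact/derivableP/(us.2 [:: j]).1.
  have hf := is_derive_flux (hj 0) (hj 1) (hj i).
  pose F y := (Num.sqrt (1 + (partial 0 u y ^+ 2 + partial 1 u y ^+ 2)))^-1 *
    partial i u y.
  have E : (fun y => (slope_factor u y *: grad u y) 0 i) = F.
    by apply/funext => y; rewrite !mxE /slope_factor sqr_enorm_grad.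
  have [_] := @line_is_derive _ _ F x 'e_i _ hf.
  by rewrite E scale0r addr0 -sqr_enorm_grad.
by rewrite /div big_ord_recl big_ord1 (_ : lift ord0 ord0 = 1) ?H//; exact: val_inj.
Qed.

(** The formula rests on the trace of the matrix of second derivatives being the
    sum of its diagonal entries in any orthonormal frame, and on only the entry
    along the gradient being damped. *)
Lemma div_flux_frame A u x n c : open A -> smooth_upto_closure A u -> A x ->
  enorm n = 1 -> grad u x = - c *: n ->
  let s := (Num.sqrt (1 + c ^+ 2))^-1 in
  slope_factor u x = s /\
  div (fun y => slope_factor u y *: grad u y) x =
  s ^+ 3 * (hess u x n + (1 + c ^+ 2) * hess u x (rot90 n)).
Proof.
move=> Ao us Ax n1 gE s.
have nn := unit_sqr n1.
have sE : slope_factor u x = s.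
  by rewrite /slope_factor gE enormZ n1 mulr1 real_normK ?num_real// sqrrN.
split => //.
rewrite (div_flux Ao us Ax); lazy zeta beta; rewrite sE.
have g0 : partial 0 u x = - c * n 0 0.
  by have := congr1 (fun w : 'rV[R]_2 => w 0 0) gE; rewrite !mxE.
have g1 : partial 1 u x = - c * n 0 1.
  by have := congr1 (fun w : 'rV[R]_2 => w 0 1) gE; rewrite !mxE.
have Q0 : 0 < 1 + c ^+ 2 by rewrite ltr_wpDr// sqr_ge0.
have s2 : s ^+ 2 * (1 + c ^+ 2) = 1.
  by rewrite /s exprVn sqr_sqrtr ?ltW// mulVf// gt_eqF.
rewrite g0 g1 /hess rot90E0 rot90E1.
move: (partials [:: 0; 0] u x) (partials [:: 1; 0] u x) => a00 a10.
move: (partials [:: 0; 1] u x) (partials [:: 1; 1] u x) => a01 a11.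
have s3 : s ^+ 3 * (1 + c ^+ 2) = s by rewrite exprSr mulrAC s2 mul1r.
have -> : s * a00 = s ^+ 3 * (1 + c ^+ 2) * a00 * (n 0 0 ^+ 2 + n 0 1 ^+ 2).
  by rewrite nn mulr1 s3.
have -> : s * a11 = s ^+ 3 * (1 + c ^+ 2) * a11 * (n 0 0 ^+ 2 + n 0 1 ^+ 2).
  by rewrite nn mulr1 s3.
by ring.
Qed.

(** Touching fixes the gradient of [u] at [x] and bounds its second derivatives
    along [n] and [rot90 n] from below, which makes the left side of the
    equation larger than [barrier_strict] allows. *)
Lemma no_touching A u alpha x n y0 : open A -> 1 < alpha ->
  is_solution A alpha u -> A x -> enorm n = 1 -> 0 < y0 < pi / 2 ->
  (\forall t \near (0 : R),
     u x - barrier alpha y0 <= u (x + t *: n) - barrier alpha (y0 - t)) ->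
  (\forall t \near (0 : R), u x <= u (x + t *: rot90 n)) -> False.
Proof.
move=> Ao a1 [us /(_ x) + _] Ax n1 /andP[y00 y0pi] minn mint.
move=> /(_ Ax) eqn.
have nn := unit_sqr n1.
have cosy : 0 < cos y0.
  by apply: cos_gt0_pihalf; rewrite y0pi andbT; have := pi_gt0 R; lra.
have idB t : is_derive t (1 : R) (fun t => y0 - t) (- 1).
  apply: (is_derive_eq (is_deriveB (is_derive_cst y0 t (1 : R)) (is_derive_id t (1 : R)))).
  by rewrite sub0r.
have mint' : \forall t \near (0 : R),
    u (x + 0 *: rot90 n) <= u (x + t *: rot90 n) by rewrite scale0r addr0.
have [tau0 tau2] := local_min_test (is_derive_line1 (rot90 n) Ao us Ax)
  (is_derive_line2 (rot90 n) Ao us Ax) mint'.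
have kd : \forall t \near (0 : R), is_derive t (1 : R)
    (fun t => u (x + t *: n) - barrier alpha (y0 - t))
    (dot n (grad u (x + t *: n)) + dbarrier alpha (y0 - t)).
  near=> t.
  have cost : 0 < cos (y0 - t).
    have : `|t| < y0 by near: t; exact: near0_norm_lt.
    have : `|t| < pi / 2 - y0 by near: t; apply: near0_norm_lt; rewrite subr_gt0.
    rewrite !ltr_norml => /andP[? ?] /andP[? ?].
    by apply: cos_gt0_pihalf; apply/andP; split; have := pi_gt0 R; lra.
  have h1 : is_derive t (1 : R) (fun t => u (x + t *: n)) (dot n (grad u (x + t *: n))).
    by near: t; exact: (is_derive_line1 n Ao us Ax).
  have h2 := @is_derive1_comp _ (barrier alpha) (fun t => y0 - t) t _ _
    (is_derive_barrier a1 cost) (idB t).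
  apply: (is_derive_eq (is_deriveB h1 h2)).
  by rewrite mulrN1 opprK.
have kdd : is_derive (0 : R) (1 : R)
    (fun t => dot n (grad u (x + t *: n)) + dbarrier alpha (y0 - t))
    (hess u x n - ddbarrier alpha y0).
  have cos0 : 0 < cos (y0 - 0) by rewrite subr0.
  have h2 := @is_derive1_comp _ (dbarrier alpha) (fun t => y0 - t) 0 _ _
    (is_derive_dbarrier alpha cos0) (idB 0).
  apply: (is_derive_eq (is_deriveD (is_derive_line2 n Ao us Ax) h2)).
  by rewrite mulrN1 subr0.
have minn' : \forall t \near (0 : R), u (x + 0 *: n) - barrier alpha (y0 - 0)
    <= u (x + t *: n) - barrier alpha (y0 - t) by rewrite scale0r addr0 subr0.
have [n0 n2] := local_min_test kd kdd minn'.
move: n0 tau0; rewrite !scale0r !addr0 subr0 => n0 tau0.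
set c := dbarrier alpha y0 in n0.
have gE : grad u x = - c *: n.
  have {}n0 : dot n (grad u x) = - c by apply/eqP; rewrite -addr_eq0 n0.
  have dn (z w : R) :
      z = z * (n 0 0 ^+ 2 + n 0 1 ^+ 2) + w * dot (rot90 n) (grad u x).
    by rewrite nn tau0 mulr1 mulr0 addr0.
  apply: row2P; rewrite [RHS]mxE -n0.
    by rewrite [LHS](dn _ (n 0 1)) !dotE rot90E0 rot90E1; ring.
  by rewrite [LHS](dn _ (- n 0 0)) !dotE rot90E0 rot90E1; ring.
have [sE dE] := div_flux_frame Ao us Ax n1 gE.
move: eqn; rewrite dE sE => eqn.
have yy : 0 < y0 < pi / 2 by rewrite y00.
have := barrier_strict a1 yy; rewrite -/c -eqn.
set s := _^-1.
have s0 : 0 < s by rewrite invr_gt0 sqrtr_gt0 ltr_wpDr// sqr_ge0.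
rewrite ltr_pM2l ?exprn_gt0// ltNge => /negP; apply.
rewrite subr_ge0 in n2; apply: le_trans n2 _.
by rewrite lerDl mulr_ge0// addr_ge0// sqr_ge0.
Unshelve. all: by end_near. Qed.

End Solutions.

(** * Comparison with the distance function *)

Section DistanceComparison.
Context {R : realType}.
Implicit Types (A : set 'rV[R]_2) (u : 'rV[R]_2 -> R) (x v n p : 'rV[R]_2).

Lemma within_continuousB A (f g : 'rV[R]_2 -> R) :
  {within A, continuous f} -> {within A, continuous g} ->
  {within A, continuous (f - g)}.
Proof.
move=> fc gc x.
exact: (@continuousB R R^o (subspace A) f g x (fc x) (gc x)).
Qed.

Lemma inradius_proper A (d : R) : is_inradius A d -> ~` A !=set0.
Proof.
move=> [_ dmax]; apply: contrapT => Afull.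
have : d + 1 <= d.
  by apply: (dmax 0) => x _; apply: contrapT => Ax; apply: Afull; exists x.
by rewrite gerDl ler10.
Qed.

Lemma bounded_closure_compact A : bounded_set A -> compact (closure A).
Proof.
move=> [M [Mr AM]]; apply: bounded_closed_compact; last exact: closed_closure.
exists M; split => // N MN x Ax.
have cl : closed [set y : 'rV[R]_2 | `|y| <= N].
  by apply: closed_comp (@closed_le _ _) => z _; exact: norm_continuous.
apply: (cl x); apply: (closure_subset _ Ax) => y Ay.
exact: AM MN _ Ay.
Qed.

(** If the segment through [p] along [v] avoids [A], then [p] is its point
    nearest to [x], so [x - p] is orthogonal to [v]; in the plane this makes [v]
    parallel to [rot90 (x - p)]. *)
Lemma nearest_tangent A x p v : ~` A !=set0 ->
  enorm (x - p) = cdist A x -> v != 0 ->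
  (\forall s \near (0 : R), ~ A (p + s *: v)) ->
  \forall s \near (0 : R), ~ A (p + s *: rot90 (x - p)).
Proof.
move=> Aprop xp v0 Av.
set w := x - p.
have Av' (c : R) : \forall s \near (0 : R), ~ A (p + (s * c) *: v).
  have sc : s * c @[s --> (0 : R)] --> (0 : R).
    by rewrite -[X in _ --> X](mul0r c); apply: cvgMr_tmp; exact: cvg_id.
  exact: sc _ Av.
pose m := dot w v.
have m0 : m = 0.
  apply: contrapT => /eqP m0.
  have c0 : 0 < dot v v + 1 by rewrite ltr_wpDl// dot_ge0.
  (* a short step from [p] towards the foot of the perpendicular from [x] *)
  near (0 : R)^'+ => t.
  have t0 : 0 < t by near: t; exact: nbhs_right_gt.
  have tv : t * dot v v < 2.
    apply: (@le_lt_trans _ _ (t * (dot v v + 1))); first by rewrite ler_pM2l// lerDl.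
    by rewrite -ltr_pdivlMr//; near: t; apply: nbhs_right_lt; rewrite divr_gt0.
  have : ~ A (p + (t * m) *: v).
    by near: t; apply: cvg_within; exact: Av'.
  move=> /(@cdist_le _ _ Aprop x); rewrite -xp.
  rewrite -(@ler_pXn2r _ 2)// ?nnegrE ?enorm_ge0// !sqr_enorm.
  have -> : x - (p + (t * m) *: v) = w - (t * m) *: v by rewrite opprD addrA.
  have -> : dot (w - (t * m) *: v) (w - (t * m) *: v)
     = dot w w - t * m ^+ 2 * (2 - t * dot v v).
    by rewrite /m !dotE !mxE; ring.
  rewrite -/w -subr_ge0 addrAC subrr sub0r oppr_ge0 leNgt => /negP; apply.
  by rewrite mulr_gt0 ?subr_gt0// mulr_gt0// exprn_even_gt0.
have vv : dot v v != 0.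
  by apply: contra v0 => /eqP vv; apply/eqP/enorm_eq0; rewrite /enorm vv sqrtr0.
pose c := dot (rot90 w) v / dot v v.
apply: filterS (Av' c) => s; suff -> : (s * c) *: v = s *: rot90 w by [].
rewrite -scalerA; congr (_ *: _).
have {}m0 : w 0 0 * v 0 0 + w 0 1 * v 0 1 = 0 by rewrite -dotE.
apply: (@scalerI _ _ (dot v v)) => //; rewrite scalerA /c mulrCA mulfV// mulr1.
apply: row2P; rewrite [LHS]mxE [RHS]mxE !dotE !rot90E0 !rot90E1.
  have -> : (- w 0 1 * v 0 0 + w 0 0 * v 0 1) * v 0 0 =
    (v 0 0 * v 0 0 + v 0 1 * v 0 1) * - w 0 1
    + (w 0 0 * v 0 0 + w 0 1 * v 0 1) * v 0 1 by ring.
  by rewrite m0 mul0r addr0.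
have -> : (- w 0 1 * v 0 0 + w 0 0 * v 0 1) * v 0 1 =
  (v 0 0 * v 0 0 + v 0 1 * v 0 1) * w 0 0
  - (w 0 0 * v 0 0 + w 0 1 * v 0 1) * v 0 0 by ring.
by rewrite m0 mul0r subr0.
Unshelve. all: by end_near. Qed.

Section Comparison.
Variables (Omega : set 'rV[R]_2) (d alpha D : R) (u : 'rV[R]_2 -> R).
Hypotheses (Oo : open Omega) (Obd : bounded_set Omega) (On0 : Omega !=set0).
Hypotheses (Osm : smooth_boundary Omega) (Ocv : strictly_convex Omega).
Hypotheses (dinr : is_inradius Omega d) (a1 : 1 < alpha).
Hypotheses (dD : d < D) (Dpi : D < pi / 2) (usol : is_solution Omega alpha u).

Let Oprop : ~` Omega !=set0 := inradius_proper dinr.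
Local Notation delta := (cdist Omega).

(** The argument of the barrier stays away from [0], where the barrier would
    only be a weak subsolution, and from [pi / 2], where it blows up. *)
Lemma depth_range x : 0 < D - delta x < pi / 2.
Proof.
have := cdist_ge0 Oo Oprop x; have := cdist_le_inradius Oprop x dinr.
move: dD Dpi => ? ? ? ?; apply/andP; split; lra.
Qed.

Definition gap x := u x - barrier alpha (D - delta x).

Lemma gap_continuous : {within closure Omega, continuous gap}.
Proof.
have gapE : gap = u - (fun x => barrier alpha (D - delta x)) by [].
have bc : continuous (fun x => barrier alpha (D - delta x)).
  move=> y; apply: (@continuous_comp _ _ _ (fun y => D - delta y) (barrier alpha)).
    apply: (@continuousB _ _ _ (cst D) delta); first exact: cst_continuous.
    exact: continuous_cdist.
  apply/differentiable_continuous/derivable1_diffP.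
  have /andP[y0 y1] := depth_range y.
  have cy : 0 < cos (D - delta y).
    by apply: cos_gt0_pihalf; rewrite y1 andbT; have := pi_gt0 R; lra.
  by have [] := is_derive_barrier a1 cy.
have [[uc _] _ _] := usol.
rewrite gapE; apply: within_continuousB; first exact: uc.
exact: continuous_subspaceT.
Qed.

Lemma gap_min_outside x : Omega x ->
  (forall y, closure Omega y -> gap x <= gap y) -> False.
Proof.
move=> Ox xmin.
have [p Op xp] := cdist_attained Oo Oprop x.
have fp : frontier Omega p := nearest_frontier Oprop Op xp Ox.
have [v v0 Ov] := tangent_segment Oo Osm Ocv fp.
have Ot := nearest_tangent Oprop xp v0 Ov.
have d0 : 0 < delta x.
  rewrite lt_neqAle cdist_ge0// andbT; apply/eqP => /esym d0.
  apply: Op; suff -> : p = x by [].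
  by apply/esym/eqP; rewrite -subr_eq0; apply/eqP/enorm_eq0; rewrite xp.
pose n := (delta x)^-1 *: (x - p).
have xpn : x - p = delta x *: n by rewrite scalerA mulfV ?gt_eqF// scale1r.
have n1 : enorm n = 1.
  by rewrite enormZ xp gtr0_norm ?invr_gt0// mulVf// gt_eqF.
have y0r := depth_range x.
have xO : nbhs x Omega by exact: open_nbhs_nbhs.
apply: (@no_touching _ Omega u alpha x n (D - delta x)) => //.
- near=> t.
  have Ot' : Omega (x + t *: n) by near: t; exact: near_line.
  have td : `|t| < delta x by near: t; exact: near0_norm_lt.
  have tD : `|t| < D - delta x.
    by near: t; apply: near0_norm_lt; case/andP: y0r.
  apply: le_trans (xmin _ (subset_closure Ot')) _.
  rewrite /gap lerD2l lerN2.
  have /andP[y0 y1] := depth_range (x + t *: n).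
  move: td tD; rewrite !ltr_norml => /andP[td1 td2] /andP[tD1 tD2].
  apply: barrier_le => //; first by rewrite subr_ge0 ltW.
  rewrite -addrA lerD2l -opprD lerN2.
  apply: le_trans (cdist_le Oprop _ Op) _.
  have -> : x + t *: n - p = (delta x + t) *: n.
    by rewrite addrAC xpn scalerDl.
  by rewrite enormZ n1 mulr1 gtr0_norm// -ltrBlDl sub0r.
- have rE (s : R) : s *: rot90 n = (s / delta x) *: rot90 (x - p).
    by apply: row2P; rewrite !mxE/=; ring.
  have Ot' : \forall s \near (0 : R), ~ Omega (p + s *: rot90 n).
    have sc : s / delta x @[s --> (0 : R)] --> (0 : R).
      rewrite -[X in _ --> X](mul0r (delta x)^-1); apply: cvgMr_tmp; exact: cvg_id.
    by near=> s; rewrite rE; near: s; exact: sc _ Ot.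
  near=> t.
  have Oxt : Omega (x + t *: rot90 n) by near: t; exact: near_line.
  have := xmin _ (subset_closure Oxt); rewrite /gap.
  move=> /le_trans h.
  have {h} : u x - barrier alpha (D - delta x)
      <= u (x + t *: rot90 n) - barrier alpha (D - delta x).
    apply: h; rewrite lerD2l lerN2.
    have /andP[y0 y1] := depth_range (x + t *: rot90 n).
    apply: barrier_le => //; first by case/andP: y0r => /ltW.
    rewrite lerD2l lerN2.
    have Opt : ~ Omega (p + t *: rot90 n) by near: t.
    apply: le_trans (cdist_le Oprop _ Opt) _.
    by rewrite opprD addrACA subrr addr0 xp.
  by rewrite lerD2r.
Unshelve. all: by end_near. Qed.

Lemma solution_ge x : closure Omega x -> - barrier alpha D <= u x.
Proof.
move=> Ox.
have [||c cO cmin] := @EVT_min_rV R 2 gap (closure Omega) _ (bounded_closure_compact Obd).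
- by case: On0 => y Oy; exists y; exact: subset_closure.
- exact: gap_continuous.
have {}cmin y : closure Omega y -> gap c <= gap y by move=> Oy; apply: cmin; rewrite inE.
rewrite inE in cO.
have nOc : ~ Omega c by move=> Oc; exact: (gap_min_outside Oc cmin).
have uc : u c = 0.
  by have [_ _ ub] := usol; apply: ub; split => // /interior_subset.
have := cmin _ Ox; rewrite /gap uc cdist_out// subr0 sub0r.
have /andP[y0 y1] := depth_range x.
have := @barrier_le _ _ a1 0 _ (lexx 0) (ltW y0) y1.
rewrite {1}/barrier cos0 powR1 subrr mulr0; lra.
Qed.

End Comparison.
End DistanceComparison.

Theorem theorem6p1 (R : realType) (Omega : set 'rV[R]_2) (d alpha umin : R)
    (u : 'rV[R]_2 -> R)
    (Omega_domain : domain Omega)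
    (Omega_bounded : bounded_set Omega)
    (Omega_smooth : smooth_boundary Omega)
    (Omega_convex : strictly_convex Omega)
    (d_inradius : is_inradius Omega d)
    (alpha_gt1 : 1 < alpha)
    (d_lt : d < pi / 2)
    (u_sol : is_solution Omega alpha u)
    (umin_min : is_min_on (closure Omega) u umin) :
  - umin <= (alpha - 1)^-1 * ((cos d)^-1 `^ (alpha - 1) - 1).
Proof.
have [Oo _ On0] := Omega_domain.
have [[x Ox ux] _] := umin_min.
have Oprop := inradius_proper d_inradius.
have d0 : 0 <= d.
  exact: le_trans (cdist_ge0 Oo Oprop x) (cdist_le_inradius Oprop x d_inradius).
have cd : 0 < cos d.
  by apply: cos_gt0_pihalf; rewrite d_lt andbT; have := pi_gt0 R; lra.
have -> : (alpha - 1)^-1 * ((cos d)^-1 `^ (alpha - 1) - 1) = barrier alpha d.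
  rewrite /barrier -(powR_inv1 (ltW cd)) -powRrM; congr (_ * (_ `^ _ - 1)); ring.
have bc : barrier alpha D @[D --> d^'+] --> barrier alpha d.
  apply: cvg_at_right_filter; apply/differentiable_continuous/derivable1_diffP.
  by have [] := is_derive_barrier alpha_gt1 cd.
apply: cvgr_to_ge bc _; near=> D.
have dD : d < D by near: D; exact: nbhs_right_gt.
have Dpi : D < pi / 2 by near: D; exact: nbhs_right_lt.
rewrite -ux lerNl.
exact: (solution_ge Oo Omega_bounded On0 Omega_smooth Omega_convex d_inradius alpha_gt1 dD Dpi u_sol Ox).
Unshelve. all: by end_near. Qed.
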